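(* Let $n,d,t$ be positive integers with $d,t\le n$, let $K$ be a field, and let $I=I_{n,d,t}\subset S=K[x_1,\ldots,x_n]$ be the $t$-spread Veronese ideal of degree $d$. Then $\operatorname{HS}_1(I)$ has linear quotients.
   Context: A monomial $x_{i_1}x_{i_2}\cdots x_{i_d}$ with $i_1\le i_2\le\cdots\le i_d$ is $t$-spread if $i_j-i_{j-1}\ge t$ for $2\le j\le d$. $I_{n,d,t}$ is the ideal of $S=K[x_1,\ldots,x_n]$ generated by all $t$-spread monomials of degree $d$. For a monomial ideal $I\subset S$ with minimal $\mathbb Z^n$-graded free resolution $\mathbb F\to I$, $F_i=\bigoplus_{j=1}^{b_i}S(-\mathbf a_{ij})$, the $i$th homological shift ideal is $\operatorname{HS}_i(I)=(\mathbf x^{\mathbf a_{ij}}: j=1,\ldots,b_i)$ (zero if $F_i=0$). A monomial ideal $J$ has linear quotients if its minimal monomial generators can be ordered $u_1,\ldots,u_m$ so that for every $2\le j\le m$ the colon ideal $(u_1,\ldots,u_{j-1}):(u_j)$ is generated by a subset of the variables. *)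

(* Defs.v *)
From HB Require Import structures.
From mathcomp Require Import all_boot all_order all_algebra.
From mathcomp Require Import mpoly.

Set Implicit Arguments.
Unset Strict Implicit.
Unset Printing Implicit Defensive.

Import GRing.Theory.
Local Open Scope ring_scope.

(* Subsets of S = K[x_1, ..., x_n], in particular ideals, are Prop-valued
   predicates: the idealr structure of ring_quotient covers only proper ideals
   with decidable membership. *)
Definition ideal_gen (R : comNzRingType) (G : R -> Prop) (p : R) : Prop :=
  exists s : seq (R * R),
    (forall x, x \in s -> G x.2) /\ p = \sum_(x <- s) x.1 * x.2.

Definition colon_ideal (R : comNzRingType) (I J : R -> Prop) (p : R) : Prop :=
  forall q, J q -> I (p * q).

Section MonomialIdeals.
Variables (K : fieldType) (n : nat).
Local Notation S := {mpoly K[n]}.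

Definition monomial_ideal (A : 'X_{1..n} -> Prop) : S -> Prop :=
  ideal_gen (fun p => exists2 m, A m & p = 'X_[m]).

Definition variable_ideal (V : {set 'I_n}) : S -> Prop :=
  ideal_gen (fun p => exists2 i, i \in V & p = 'X_i).

(* The zero ideal has the empty sequence as its minimal generators. *)
Definition minimal_monomial_generators (J : S -> Prop) (us : seq 'X_{1..n}) :=
  [/\ uniq us,
      forall p, J p <-> monomial_ideal (fun m => m \in us) p &
      forall u, u \in us ->
        ~ monomial_ideal (fun m => m \in rem u us) 'X_[u]].

(* Positions are numbered from 0, so 0 < j is the usual 2 <= j <= m. *)
Definition linear_quotients (J : S -> Prop) : Prop :=
  exists us : seq 'X_{1..n}, minimal_monomial_generators J us /\
    forall j, (0 < j < size us)%N ->
      exists V : {set 'I_n}, forall p,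
        colon_ideal (monomial_ideal (fun m => m \in take j us))
                    (monomial_ideal (fun m => m = nth 0%MM us j)) p
        <-> variable_ideal V p.

(* The indices i_1, ..., i_d are listed by s; sorted is the condition on
   consecutive entries. *)
Definition t_spread (d t : nat) (m : 'X_{1..n}) : Prop :=
  exists s : d.-tuple 'I_n,
    sorted (fun i j : 'I_n => (i <= j)%N && (t <= j - i)%N) s /\
    m = (\sum_(i <- s) U_(i))%MM.

Definition t_spread_veronese (d t : nat) : S -> Prop :=
  monomial_ideal (t_spread d t).

(* ... -> F_1 -> F_0 -> S, where F_i is the direct sum of the S(-a_ij) for
   j < rank i, with a_ij = shift i j. Elements of F_i are row vectors and maps
   act by right multiplication; aug is the map F_0 -> S. The shifts are taken
   in N^n: as I is contained in S, no other element of Z^n can occur in a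
   minimal resolution of I. *)
Record free_complex := FreeComplex {
  rank : nat -> nat;
  shift : forall i, 'I_(rank i) -> 'X_{1..n};
  aug : 'cV[S]_(rank 0);
  diff : forall i, 'M[S]_(rank i.+1, rank i)
}.

(* The jth basis vector of F_i has degree a_ij and the maps preserve degrees. *)
Definition multigraded (F : free_complex) : Prop :=
  (forall (j : 'I_(rank F 0)) m, m \in msupp (aug F j 0) -> m = shift j) /\
  (forall i (j : 'I_(rank F i.+1)) (k : 'I_(rank F i)) m,
     m \in msupp (diff F i j k) -> (m + shift k)%MM = shift j).

Definition resolves (F : free_complex) (I : S -> Prop) : Prop :=
  [/\ forall p, I p <-> exists v : 'rV[S]_(rank F 0), p = (v *m aug F) 0 0,
      forall v : 'rV[S]_(rank F 0),
        v *m aug F = 0 <-> exists w, v = w *m diff F 0 &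
      forall i (v : 'rV[S]_(rank F i.+1)),
        v *m diff F i = 0 <-> exists w, v = w *m diff F i.+1].

Definition minimal (F : free_complex) : Prop :=
  forall i (j : 'I_(rank F i.+1)) (k : 'I_(rank F i)),
    variable_ideal [set: 'I_n] (diff F i j k).

Definition minimal_multigraded_resolution (F : free_complex) (I : S -> Prop) :=
  [/\ multigraded F, resolves F I & minimal F].

(* This depends only on the ideal resolved by F, since minimal multigraded
   free resolutions are unique up to isomorphism. *)
Definition homological_shift_ideal (i : nat) (F : free_complex) : S -> Prop :=
  monomial_ideal (fun m => exists j : 'I_(rank F i), m = shift j).

End MonomialIdeals.

Arguments free_complex : clear implicits.
Arguments t_spread_veronese : clear implicits.

(* Main.v *)
Require Import Defs.
From mathcomp Require Import all_boot all_order all_algebra.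
From mathcomp Require Import mpoly.
From mathcomp Require Import zify.

(** Call a monomial [m] of degree [d + 1] a linear syzygy of a set of monomials
    of degree [d] if at least two of them divide [m]; [m] is then their lcm. The
    proof shows that HS_1 of an ideal generated in degree [d] with linear
    quotients is generated by its linear syzygies, and that these can be ordered
    so as to have linear quotients.

    The t-spread monomials, listed in decreasing lexicographic order, have linear
    quotients. If [u] comes before [v] and [x_i] is the first variable in which
    they differ, replace by [x_i] the next variable of [v]: the result is again
    t-spread, precedes [v] and divides [x_i v] ([spread_exchange]).

    Linear quotients imply that syzygies are generated linearly: for distinct
    generators [u], [v] dividing [m], some linear syzygy divisible by [u]
    divides [m] ([linear_quotient_seq_related]). This determines HS_1
    ([homological_shift1P]). On the one hand a row of the matrix F_1 -> F_0 in
    degree [a] is a nonzero relation between the generators of the ideal, so it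
    involves two of them; both divide [a], hence so does a linear syzygy. On the
    other hand a linear syzygy [m] of [u] and [v] gives a cycle in
    degree [m], up to scalars [x_i e_u - x_j e_v] with [x_i u = x_j v = m], and a
    row needed to express it as a boundary has a degree dividing [m].

    For the order, add the generators one at a time and append the new linear
    syzygies in any order ([linear_colon_rcons]). A new syzygy [m] that comes
    with the generator [v] is a multiple of [v] and of an earlier generator [r].
    Any syzygy [w] listed before [m] is divisible by an earlier generator
    [k <> r], for otherwise [w] and [m] would both be the lcm of [r] and [v].
    The step from [r] towards [k] inside lcm(m, w) is an old linear syzygy
    [x_y r], different from [m]; then [x_y] divides [w : m], and [x_y r]
    divides [x_y m]. *)

Set Implicit Arguments.
Unset Strict Implicit.
Unset Printing Implicit Defensive.

Import Order.TTheory GRing.Theory.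

Local Open Scope nat_scope.

(** * Linear quotients of monomial sequences *)

Section LinearQuotientSequences.
Variable n : nat.
Implicit Types (m u v w : 'X_{1..n}) (us hs : seq 'X_{1..n}).

Definition lcm_mnm u v : 'X_{1..n} := [multinom maxn (u i) (v i) | i < n].

Lemma lepm_lcml u v : (u <= lcm_mnm u v)%MM.
Proof. by apply/mnm_lepP=> i; rewrite mnmE leq_maxl. Qed.

Lemma lepm_lcmr u v : (v <= lcm_mnm u v)%MM.
Proof. by apply/mnm_lepP=> i; rewrite mnmE leq_maxr. Qed.

Lemma lepm_mdeg m1 m2 : (m1 <= m2)%MM -> mdeg m1 <= mdeg m2.
Proof. by move=> /mnm_lepP le; rewrite !mdegE leq_sum. Qed.

Lemma lepm_mdeg_eq m1 m2 : (m1 <= m2)%MM -> mdeg m1 = mdeg m2 -> m1 = m2.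
Proof.
move=> /submK <-; rewrite mdegD -[LHS]add0n => /addIn/esym/eqP.
by rewrite mdeg_eq0 => /eqP->; rewrite add0m.
Qed.

Lemma lepm_mdegS m1 m2 :
  (m1 <= m2)%MM -> mdeg m2 = (mdeg m1).+1 -> exists i, m2 = (U_(i) + m1)%MM.
Proof.
move=> /submK <-; rewrite mdegD -[RHS]add1n => /addIn/eqP/mdeg1P[i /eqP->].
by exists i.
Qed.

(** A common multiple of degree [d + 1] of two distinct monomials of degree [d] is
    their lcm. *)
Lemma lcm_mnm_mdegS u v m :
  u != v -> mdeg u = mdeg v -> mdeg m = (mdeg u).+1 ->
  (u <= m)%MM -> (v <= m)%MM -> m = lcm_mnm u v.
Proof.
move=> u'v eq_d dm /mnm_lepP le_um /mnm_lepP le_vm; apply/esym.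
have le_lcm : (lcm_mnm u v <= m)%MM.
  by apply/mnm_lepP=> i; rewrite mnmE geq_max le_um le_vm.
apply: lepm_mdeg_eq => //; apply/eqP; rewrite eqn_leq lepm_mdeg //= dm.
rewrite ltn_neqAle lepm_mdeg ?lepm_lcml ?andbT //; apply: contra u'v => /eqP d_lcm.
have {1}-> : u = lcm_mnm u v by apply: lepm_mdeg_eq; rewrite ?lepm_lcml.
by rewrite eq_sym; apply/eqP/lepm_mdeg_eq; rewrite ?lepm_lcmr -?eq_d.
Qed.

(** The colon ideal (us) : v is generated by variables: for every [w] in [us] some
    variable [x_i] dividing [w : v] lies in (us) : v. *)
Definition linear_colon us v :=
  forall w, w \in us ->
    exists2 i, v i < w i & exists2 w', w' \in us & (w' <= U_(i) + v)%MM.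

(** Linear quotients with respect to the given order of the list; for distinct
    monomials of one degree it gives the usual notion ([linear_quotients_of_seq]). *)
Definition linear_quotient_seq us :=
  forall j, j < size us -> linear_colon (take j us) (nth 0%MM us j).

Lemma linear_quotient_seq_rcons us v :
  linear_quotient_seq (rcons us v) <->
  linear_quotient_seq us /\ linear_colon us v.
Proof.
split=> [lq | [lq lc] j].
  split=> [j lt_j|].
    have := lq j; rewrite size_rcons ltnS (ltnW lt_j) nth_rcons lt_j.
    by rewrite -cats1 takel_cat ?(ltnW lt_j) //; apply.
  have := lq (size us); rewrite size_rcons ltnSn nth_rcons ltnn eqxx.
  by rewrite -cats1 take_size_cat //; apply.
rewrite size_rcons ltnS leq_eqVlt => /predU1P[->|lt_j].
  by rewrite -cats1 take_size_cat // nth_cat ltnn subnn.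
by rewrite -cats1 takel_cat ?(ltnW lt_j) // nth_cat lt_j; apply: lq.
Qed.

(** The first syzygies of [us] are linear, in the form of a single step: if [u] and
    [v] divide [m], a monomial of degree [d + 1] dividing [m] is divisible by [u]
    and by another element of [us], not necessarily [v]. *)
Definition linearly_related d us :=
  forall u v m, u \in us -> v \in us -> v != u -> (u <= m)%MM -> (v <= m)%MM ->
  exists m' w, [/\ mdeg m' = d.+1, (m' <= m)%MM, (u <= m')%MM &
                   [/\ w \in us, w != u & (w <= m')%MM]].

Definition equigenerated d us := forall u, u \in us -> mdeg u = d.

Lemma equigenerated_rcons d us v :
  equigenerated d (rcons us v) -> equigenerated d us /\ mdeg v = d.
Proof.
move=> eq_d; split=> [u us_u|]; apply: eq_d; rewrite mem_rcons inE ?eqxx //.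
by rewrite us_u orbT.
Qed.

(** Induction on the list: the colon ideal by the last generator [v] gives the step
    away from [v], and for the step from [u] towards [v] it gives a [w'] in the
    prefix close to [v]; if [w' = u] the step leads to [v], otherwise it is the
    step from [u] towards [w'] in the prefix. *)
Lemma linear_quotient_seq_related d us :
  uniq us -> equigenerated d us -> linear_quotient_seq us ->
  linearly_related d us.
Proof.
elim/last_ind: us => [//|us v IH]; rewrite rcons_uniq => /andP[v'us us_uniq].
case/equigenerated_rcons=> us_d v_d /linear_quotient_seq_rcons[lq lc].
have {IH lq} rel := IH us_uniq us_d lq.
have sub w : w \in us -> w \in rcons us v by rewrite mem_rcons inE orbC => ->.
have step w m : w \in us -> (w <= m)%MM -> (v <= m)%MM ->
    exists m' w', [/\ mdeg m' = d.+1, (m' <= m)%MM, (v <= m')%MM &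
                   [/\ w' \in us, w' != v & (w' <= m')%MM]].
  move=> us_w /mnm_lepP le_wm /mnm_lepP le_vm.
  have [i lt_i [w' us_w' le_w']] := lc _ us_w.
  exists (U_(i) + v)%MM, w'; split; rewrite ?lem_addl ?mdegD ?mdeg1 ?v_d //.
    apply/mnm_lepP=> k; rewrite mnmDE mnm1E; case: eqP => [<-|_] /=; last exact: le_vm.
    exact: leq_trans (le_wm i).
  by split=> //; apply: contraNneq v'us => <-.
move=> u w m; rewrite !mem_rcons !inE.
case: (eqVneq u v) => [->|u'v] /=; case: (eqVneq w v) => [->|w'v] //=.
- move=> _ us_w _ le_vm le_wm.
  have [m' [w' [? ? ? [? ? ?]]]] := step w m us_w le_wm le_vm.
  by exists m', w'; split=> //; split=> //; apply: sub.
- move=> us_u _ _ le_um le_vm.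
  have [m' [w' [dm' le_m' le_v [us_w' w'v le_w']]]] :=
    step u m us_u le_um le_vm.
  case: (eqVneq w' u) => [eq_u|w'u].
    exists m', v; split; rewrite -?eq_u //; split; rewrite ?mem_rcons ?inE ?eqxx //.
    by rewrite eq_sym.
  have [m2 [w2 [? ? ? [? ? ?]]]] :=
    rel u w' m us_u us_w' w'u le_um (lepm_trans le_w' le_m').
  by exists m2, w2; split=> //; split=> //; apply: sub.
- move=> us_u us_w w'u le_um le_wm.
  have [m2 [w2 [? ? ? [? ? ?]]]] := rel u w m us_u us_w w'u le_um le_wm.
  by exists m2, w2; split=> //; split=> //; apply: sub.
Qed.

(** The monomials of degree [d + 1] that are lcms of two distinct elements of [us],
    when these have degree [d]. *)
Definition linear_syzygy d us m :=
  mdeg m = d.+1 /\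
  exists u v, [/\ u \in us, v \in us, u != v, (u <= m)%MM & (v <= m)%MM].

Lemma linear_syzygy_sub d us us' m :
  {subset us <= us'} -> linear_syzygy d us m -> linear_syzygy d us' m.
Proof.
by move=> sub [dm [u [v [/sub ? /sub ? ? ? ?]]]]; split=> //; exists u, v.
Qed.

Lemma linear_syzygy_step d us u v m :
  equigenerated d us -> linearly_related d us ->
  u \in us -> v \in us -> v != u -> (u <= m)%MM -> (v <= m)%MM ->
  exists m', [/\ linear_syzygy d us m', (u <= m')%MM & (m' <= m)%MM].
Proof.
move=> eq_d rel us_u us_v v'u le_u le_v.
have [m' [w [dm' le_m' le_u' [us_w w'u le_w]]]] := rel u v m us_u us_v v'u le_u le_v.
by exists m'; split=> //; split=> //; exists u, w; rewrite eq_sym.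
Qed.

(** Here [hs] contains all linear syzygies of [us] and possibly some of those that
    appear when the generator [v] is added; [m] is one of the remaining ones. *)
Lemma linear_colon_rcons d us v hs m :
  uniq (rcons us v) -> equigenerated d (rcons us v) ->
  linear_quotient_seq (rcons us v) ->
  (forall h, h \in hs -> linear_syzygy d (rcons us v) h) ->
  (forall h, linear_syzygy d us h -> h \in hs) ->
  m \notin hs -> linear_syzygy d (rcons us v) m ->
  linear_colon hs m.
Proof.
move=> us_uniq us_d lq hs_syz syz_hs hs'm [dm syz_m] w hs_w.
have rel : linearly_related d us.
  apply: linear_quotient_seq_related.
  - by move: us_uniq; rewrite rcons_uniq => /andP[].
  - by case/equigenerated_rcons: us_d.
  - by case/linear_quotient_seq_rcons: lq.
have us_d' : equigenerated d us by case/equigenerated_rcons: us_d.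
(* As [m] is not a linear syzygy of [us], one of the two divisors is [v]. *)
have [r [us_r le_r le_v]] : exists r, [/\ r \in us, (r <= m)%MM & (v <= m)%MM].
  case: syz_m => r [s []]; rewrite !mem_rcons !inE.
  move=> /predU1P[->|us_r] /predU1P[->|us_s] r's le_r le_s.
  - by rewrite eqxx in r's.
  - by exists s.
  - by exists r.
  - by case/negP: hs'm; apply: syz_hs; split=> //; exists r, s.
(* If [r] were the only divisor of [w] in [us], then [w] would be the lcm of [r]
   and [v], that is, [m]. *)
have [k [us_k k'r le_k]] : exists k, [/\ k \in us, k != r & (k <= w)%MM].
  have [dw [k [l [+ + k'l le_k le_l]]]] := hs_syz _ hs_w.
  have other x y : x \in us -> y \in us -> x != y -> (x <= w)%MM -> (y <= w)%MM ->
      exists k, [/\ k \in us, k != r & (k <= w)%MM].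
    case: (eqVneq x r) => [->|x'r] us_x us_y x'y lex ley; last by exists x.
    by exists y; rewrite us_y eq_sym.
  have mixed x : x \in us -> (x <= w)%MM -> (v <= w)%MM ->
      exists k, [/\ k \in us, k != r & (k <= w)%MM].
    case: (eqVneq x r) => [eq_x|x'r] us_x le_x le_v'; last by exists x.
    case/negP: hs'm; suff <- : w = m by [].
    have r'v : r != v.
      by apply: contraTneq us_r => ->; move: us_uniq; rewrite rcons_uniq => /andP[].
    have dv : mdeg v = d by apply: us_d; rewrite mem_rcons mem_head.
    have dr : mdeg r = d by apply: us_d'.
    rewrite (lcm_mnm_mdegS (m := w) r'v) ?dr ?dv // -?eq_x //.
    by rewrite (lcm_mnm_mdegS (m := m) r'v) ?dr ?dv // eq_x.
  rewrite !mem_rcons !inE => /predU1P[eq_k|us_k] /predU1P[eq_l|us_l].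
  - by rewrite eq_k eq_l eqxx in k'l.
  - by apply: (mixed l); rewrite -?eq_k.
  - by apply: (mixed k); rewrite -?eq_l.
  - exact: (other k l).
(* The step from [r] towards [k]; all of it divides the lcm of [m] and [w]. *)
have [h [syz_h le_rh le_h]] :=
  linear_syzygy_step us_d' rel us_r us_k k'r
    (lepm_trans le_r (lepm_lcml m w)) (lepm_trans le_k (lepm_lcmr m w)).
have hs_h := syz_hs _ syz_h.
have h'm : h != m by apply: contraNneq hs'm => <-.
have [y hE] : exists y, h = (U_(y) + r)%MM.
  by apply: lepm_mdegS => //; rewrite (us_d' r us_r); case: syz_h.
(* Otherwise [h] would divide, hence equal, [m]. *)
exists y.
  rewrite ltnNge; apply/negP => le_y; case/eqP: h'm; apply: lepm_mdeg_eq; last first.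
    by case: syz_h => -> _.
  apply/mnm_lepP=> i; rewrite hE mnmDE mnm1E; case: eqP => [<-|_] /=.
    move/mnm_lepP/(_ y): le_h; rewrite hE mnmDE mnm1E eqxx !mnmE. 
    by rewrite (maxn_idPl le_y).
  by rewrite add0n (mnm_lepP le_r).
exists h => //; apply/mnm_lepP=> i; rewrite hE !mnmDE leq_add2l.
exact: (mnm_lepP le_r).
Qed.

Lemma linear_quotient_seq_cat_syzygy d us v hs ns :
  uniq (rcons us v) -> equigenerated d (rcons us v) ->
  linear_quotient_seq (rcons us v) ->
  linear_quotient_seq hs ->
  (forall h, h \in hs -> linear_syzygy d (rcons us v) h) ->
  (forall h, linear_syzygy d us h -> h \in hs) ->
  uniq (hs ++ ns) ->
  (forall h, h \in ns -> linear_syzygy d (rcons us v) h) ->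
  linear_quotient_seq (hs ++ ns).
Proof.
move=> us_uniq us_d lq lq_hs hs_syz syz_hs.
elim/last_ind: ns => [|ns m IH]; first by rewrite cats0.
rewrite -rcons_cat rcons_uniq => /andP[ns'm ns_uniq] ns_syz.
have syz_ns h : h \in ns -> linear_syzygy d (rcons us v) h.
  by move=> ns_h; apply: ns_syz; rewrite mem_rcons inE ns_h orbT.
apply/linear_quotient_seq_rcons; split; first exact: IH.
apply: (linear_colon_rcons us_uniq us_d lq) => //.
- by move=> h; rewrite mem_cat => /orP[/hs_syz|/syz_ns].
- by move=> h /syz_hs; rewrite mem_cat => ->.
- by apply: ns_syz; rewrite mem_rcons mem_head.
Qed.

Theorem linear_quotient_seq_syzygy d us :
  uniq us -> equigenerated d us -> linear_quotient_seq us ->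
  exists hs, [/\ uniq hs, linear_quotient_seq hs &
                 forall m, m \in hs <-> linear_syzygy d us m].
Proof.
elim/last_ind: us => [|us v IH].
  by exists [::]; split=> // m; split=> // -[_ [u [v []]]].
move=> us_uniq us_d lq.
have [us_uniq1 v'us] : uniq us /\ v \notin us.
  by move: us_uniq; rewrite rcons_uniq => /andP[].
have [us_d1 v_d] := equigenerated_rcons us_d.
have [lq1 _] := (linear_quotient_seq_rcons us v).1 lq.
have [hs [hs_uniq lq_hs hsP]] := IH us_uniq1 us_d1 lq1.
(* The linear syzygies that appear with [v]. *)
pose isnew m := (m \notin hs) && has (fun r => (r <= m)%MM) us.
pose ns := [seq m <- [seq (U_(i) + v)%MM | i <- enum 'I_n] | isnew m].
have nsP m : m \in ns <-> m \notin hs /\ linear_syzygy d (rcons us v) m.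
  rewrite mem_filter; split=> [/andP[/andP[hs'm /hasP[r us_r le_r]]] /mapP[i _ mE]|].
    split=> //; split; first by rewrite mE mdegD mdeg1 v_d.
    exists r, v; split; rewrite ?mem_rcons ?inE ?us_r ?orbT ?eqxx //.
      by apply: contraNneq v'us => <-.
    by rewrite mE lem_addl.
  case=> hs'm [dm [u [w [us_u us_w u'w le_u le_w]]]].
  have [r us_r [le_r le_v]] : exists2 r, r \in us & (r <= m)%MM /\ (v <= m)%MM.
    move: us_u us_w u'w; rewrite !mem_rcons !inE => /predU1P[uE|us_u] /predU1P[wE|us_w].
    - by rewrite uE wE eqxx.
    - by exists w => //; rewrite -uE.
    - by exists u => //; rewrite -wE.
    - by move=> u'w; case/negP: hs'm; apply/hsP; split=> //; exists u, w.
  rewrite /isnew hs'm /=; apply/andP; split; first by apply/hasP; exists r.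
  have [i ->] := lepm_mdegS le_v (etrans dm (congr1 S (esym v_d))).
  by apply: map_f; rewrite mem_enum.
have sub : {subset us <= rcons us v} by move=> x; rewrite mem_rcons inE orbC => ->.
have uniq_cat : uniq (hs ++ ns).
  rewrite cat_uniq hs_uniq filter_uniq ?andbT /=; last first.
    rewrite map_inj_uniq ?enum_uniq // => i j /addIm/eqP.
    by rewrite eq_mnm1 => /eqP.
  by apply/hasPn=> m /nsP[].
exists (hs ++ ns); split=> //.
- apply: (linear_quotient_seq_cat_syzygy us_uniq us_d lq lq_hs) => //.
  + by move=> h /hsP; apply: linear_syzygy_sub.
  + by move=> h syz_h; apply/hsP.
  + by move=> h /nsP[].
- move=> m; rewrite mem_cat; split=> [/orP[/hsP|/nsP[]//]|syz_m].
    exact: linear_syzygy_sub.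
  by have [//|hs'm] := boolP (m \in hs); apply/nsP.
Qed.

End LinearQuotientSequences.

(** * Spread monomials *)

Section SpreadMonomials.
Variable n : nat.
Implicit Types (m u v w : 'X_{1..n}).

Definition t_gap t : rel 'I_n := fun i j => (i <= j) && (t <= j - i).

(** The exponent vector of a t-spread monomial: for positive [t], it is squarefree
    and distinct indices in its support differ by at least [t]. *)
Definition spread_exponents t m :=
  (forall i, m i <= 1) /\
  forall i j : 'I_n, i < j -> 0 < m i -> 0 < m j -> t <= j - i.

Lemma t_spreadP d t m : 0 < t ->
  t_spread d t m <-> mdeg m = d /\ spread_exponents t m.
Proof.
move=> t_gt0.
have gap_trans : transitive (t_gap t) by move=> j i k; rewrite /t_gap; lia.
split=> [[s [s_sorted ->]] | [dm [m_le1 m_gap]]].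
  have s_uniq : uniq s.
    apply: sorted_uniq s_sorted => // i; rewrite subnn; lia.
  have sE i : (\sum_(j <- s) U_(j))%MM i = (i \in val s).
    rewrite mnm_sumE -(count_uniq_mem _ s_uniq) -sum1_count [RHS]big_mkcond.
    by apply: eq_bigr => j _; rewrite mnm1E /=; case: eqP.
  split; last split=> [i|i j lt_ij].
  - rewrite mdeg_sum (eq_bigr (fun=> 1)) ?sum1_size ?size_tuple // => j _.
    by rewrite mdeg1.
  - by rewrite sE leq_b1.
  - rewrite !sE !lt0b => s_i s_j.
    have [lt_s|lt_s|eq_s] := ltngtP (index i s) (index j s).
    + by case/andP: (sorted_ltn_index gap_trans s_sorted _ _ s_i s_j lt_s).
    + have /andP[] := sorted_ltn_index gap_trans s_sorted _ _ s_j s_i lt_s; lia.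
    + by move: lt_ij; have eq_ij := index_inj i s_i s_j eq_s; rewrite eq_ij ltnn.
pose s := [seq i <- enum 'I_n | 0 < m i].
have mE i : m i = (0 < m i) by move: (m_le1 i); case: (m i) => [|[]].
have s_size : size s == d.
  rewrite size_filter -sum1_count big_mkcond big_enum -dm mdegE; apply/eqP.
  by apply: eq_bigr => i _; rewrite [RHS]mE; case: (0 < m i).
exists (Tuple s_size); split=> /=.
  apply: (@sub_in_sorted _ (fun i => 0 < m i) (fun i j : 'I_n => i < j)).
  - by move=> i j m_i m_j lt_ij; rewrite (ltnW lt_ij) m_gap.
  - by rewrite filter_all.
  - apply: sorted_filter; first by move=> j i k; apply: ltn_trans.
    by have := iota_ltn_sorted 0 n; rewrite -val_enum_ord sorted_map.
apply/mnmP=> i; rewrite mnm_sumE big_filter big_mkcond big_enum /= (bigD1 i) //=.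
rewrite big1 ?addn0 => [|j /negbTE j'i]; last by rewrite mnm1E j'i if_same.
by rewrite mnm1E eqxx [LHS]mE; case: (0 < m i).
Qed.

(** If [u] is lexicographically larger than [v], the first variable in which they
    differ can be exchanged in [v] for the next variable of [v]. The order on
    monomials of equal degree compares the exponents of the first variables
    first. *)
Lemma spread_exchange t u v :
  spread_exponents t u -> spread_exponents t v -> mdeg u = mdeg v ->
  (v < u)%O ->
  exists2 i, v i < u i &
    exists w, [/\ spread_exponents t w, mdeg w = mdeg v, (v < w)%O &
                  (w <= U_(i) + v)%MM].
Proof.
move=> [u_le1 u_gap] [v_le1 v_gap] eq_d /(ltmcP (esym eq_d))[i eq_vu lt_vu].
have vi0 : v i = 0 by move: (u_le1 i) lt_vu; lia.
exists i => //.
have [j0 P_j0] : exists j : 'I_n, (i < j) && (0 < v j).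
  apply/existsP; rewrite -[X in is_true X]negbK; apply/existsPn=> v0.
  suff : mdeg v < mdeg u by rewrite eq_d ltnn.
  rewrite !mdegE (bigD1 i) //= [X in _ < X](bigD1 i) //= -addSn.
  rewrite leq_add // leq_sum // => k k'i.
  have [lt_ki|lt_ik|eq_ki] := ltngtP k i.
  - by rewrite eq_vu.
  - by move: (v0 k); rewrite lt_ik /= -eqn0Ngt => /eqP->.
  - by rewrite (val_inj eq_ki) eqxx in k'i.
(* The first index after [i] in the support of [v]. *)
pose after_i := [pred j : 'I_n | (i < j) && (0 < v j)].
case: (@arg_minnP _ j0 after_i (fun j => j) P_j0) => j /andP[lt_ij v_j] j_min.
have le_Uv : (U_(j) <= v)%MM by rewrite lep1mP -lt0n.
pose w := (U_(i) + (v - U_(j)))%MM.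
have wE k : w k = (i == k) + (v k - (j == k)) by rewrite mnmDE mnmBE !mnm1E.
have w_gt0 k : 0 < w k -> k = i \/ 0 < v k /\ k <> j.
  rewrite wE; case: (eqVneq i k) => [->|_]; first by left.
  case: (eqVneq j k) => [->|j'k]; first by move: (v_le1 k); lia.
  by rewrite subn0 add0n => v_k; right; split=> // eq_k; rewrite eq_k eqxx in j'k.
have dw : mdeg w = mdeg v.
  by rewrite mdegD mdeg1 -{2}(submK le_Uv) mdegD mdeg1 addnC.
have j'i : (j == i) = false by apply/eqP=> eq_ji; move: lt_ij; rewrite eq_ji ltnn.
exists w; split=> //.
- split=> [k|k l lt_kl /w_gt0 k_in /w_gt0 l_in].
    rewrite wE; case: (eqVneq i k) => [<-|_]; first by rewrite vi0.
    exact: leq_trans (leq_subr _ _) (v_le1 k).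
  case: k_in l_in => [kE|[v_k k'j]] [lE|[v_l l'j]].
  + by move: lt_kl; rewrite kE lE ltnn.
  + have : j <= l by apply: j_min; rewrite /= -kE lt_kl.
    have l'jn : (l : nat) <> j by move/val_inj.
    move=> le_jl; have lt_jl : j < l by lia.
    have := v_gap _ _ lt_jl v_j v_l; move: lt_ij; rewrite kE; lia.
  + have lt_ki : k < i by rewrite -lE.
    rewrite lE; apply: u_gap => //; last exact: leq_ltn_trans lt_vu.
    by rewrite -eq_vu.
  + exact: v_gap.
- apply/ltmcP => //; exists i => [k lt_ki|]; last by rewrite wE eqxx vi0.
  rewrite wE; case: (eqVneq i k) lt_ki => [->|_ lt_ki]; first by rewrite ltnn.
  case: (eqVneq j k) lt_ki => [<- lt_ji|_ _]; last by rewrite subn0.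
  by move: (ltn_trans lt_ij lt_ji); rewrite ltnn.
- by apply/mnm_lepP=> k; rewrite wE mnmDE mnm1E leq_add2l leq_subr.
Qed.

Lemma t_spread_linear_quotient_seq d t : 0 < t ->
  exists us : seq 'X_{1..n}, [/\ uniq us, linear_quotient_seq us &
                                 forall m, m \in us <-> t_spread d t m].
Proof.
move=> t_gt0.
pose us0 := [seq (\sum_(i <- val s) U_(i))%MM |
               s : d.-tuple 'I_n in [pred s : d.-tuple 'I_n | sorted (t_gap t) s]].
pose us := sort >=%O (undup us0).
have us_uniq : uniq us by rewrite sort_uniq undup_uniq.
have usP m : m \in us <-> t_spread d t m.
  rewrite mem_sort mem_undup; split=> [/imageP[s s_sorted ->]|[s [s_sorted ->]]].
    by exists s.
  by apply/imageP; exists s.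
exists us; split=> // j lt_j u u_j.
have us_v : nth 0%MM us j \in us by rewrite mem_nth.
have us_sorted : sorted >=%O us by apply: sort_sorted; apply: ge_total.
have nth_gt k : k < j -> (nth 0%MM us j < nth 0%MM us k)%O.
  move=> lt_kj; rewrite lt_neqAle nth_uniq ?(ltn_trans lt_kj) // gtn_eqF //=.
  by apply: (sorted_ltn_nth ge_trans 0%MM us_sorted k j) => //; apply: ltn_trans lt_j.
have us_u := mem_take u_j.
have lt_vu : (nth 0%MM us j < u)%O.
  move: u_j => /(nthP 0%MM)[k]; rewrite size_take lt_j => lt_kj <-.
  by rewrite nth_take // nth_gt.
have [du spr_u] := (t_spreadP d u t_gt0).1 ((usP u).1 us_u).
have [dv spr_v] := (t_spreadP d _ t_gt0).1 ((usP _).1 us_v).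
have [i lt_i [w [spr_w dw lt_vw le_w]]] :=
  spread_exchange spr_u spr_v (etrans du (esym dv)) lt_vu.
exists i => //; exists w => //.
have us_w : w \in us by apply/usP/t_spreadP => //; rewrite dw.
rewrite in_take // ltnNge leq_eqVlt; apply/norP; split.
  by apply: contraTneq lt_vw => ->; rewrite nth_index // ltxx.
apply/negP=> lt_jw; have := sorted_ltn_nth ge_trans 0%MM us_sorted.
move=> /(_ j (index w us)); rewrite !inE lt_j index_mem us_w => /(_ isT isT lt_jw).
by rewrite nth_index // => /(lt_le_trans lt_vw); rewrite ltxx.
Qed.

End SpreadMonomials.

(** * Monomial ideals *)

Local Open Scope ring_scope.

Lemma ideal_genD (R : comNzRingType) (G : R -> Prop) p q :
  ideal_gen G p -> ideal_gen G q -> ideal_gen G (p + q).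
Proof.
move=> [s [Gs ->]] [s' [Gs' ->]]; exists (s ++ s'); rewrite big_cat; split=> // x.
by rewrite mem_cat => /orP[/Gs|/Gs'].
Qed.

Lemma ideal_gen0 (R : comNzRingType) (G : R -> Prop) : ideal_gen G 0.
Proof. by exists [::]; rewrite big_nil. Qed.

Lemma ideal_genM (R : comNzRingType) (G : R -> Prop) p q :
  G q -> ideal_gen G (p * q).
Proof.
move=> Gq; exists [:: (p, q)]; rewrite big_seq1; split=> // x.
by rewrite inE => /eqP->.
Qed.

Section MonomialIdealMembership.
Variables (K : fieldType) (n : nat).
Local Notation S := {mpoly K[n]}.
Implicit Types (p q : S) (m u v : 'X_{1..n}) (A B : 'X_{1..n} -> Prop).

Lemma msupp_mulX p q m :
  m \in msupp (p * q) -> exists2 u, u \in msupp q & (u <= m)%MM.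
Proof.
by move=> /msuppM_le/allpairsP[[a b] /= [_ q_b ->]]; exists b; rewrite ?lem_addl.
Qed.

Lemma monomial_idealP A p :
  monomial_ideal A p <->
  forall m, m \in msupp p -> exists2 a, A a & (a <= m)%MM.
Proof.
split=> [[s [As ->]] m /msupp_sum_le/flattenP[_ /mapP[x s_x ->]]|Ap].
  move: s_x; rewrite mem_filter => /andP[_ /As[a Aa ->]] /msupp_mulX[u].
  by rewrite msuppX inE => /eqP-> le_a; exists a.
rewrite [p]mpolyE big_seq; elim/big_ind: _; first exact: ideal_gen0.
  exact: ideal_genD.
move=> m /Ap[a Aa /submK <-]; rewrite mpolyXD scalerAl.
by apply: ideal_genM; exists a.
Qed.

Lemma monomial_idealX A m :
  monomial_ideal (K := K) A 'X_[m] <-> exists2 a, A a & (a <= m)%MM.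
Proof.
rewrite monomial_idealP; split=> [|? u]; first by apply; rewrite msuppX inE.
by rewrite msuppX inE => /eqP->.
Qed.

Lemma monomial_ideal_sub A B p :
  (forall a, A a -> exists2 b, B b & (b <= a)%MM) ->
  monomial_ideal A p -> monomial_ideal B p.
Proof.
rewrite !monomial_idealP => AB Ap m /Ap[a /AB[b Bb le_ba] le_am].
by exists b => //; apply: lepm_trans le_am.
Qed.

Lemma variable_idealP (V : {set 'I_n}) p :
  variable_ideal V p <->
  forall m, m \in msupp p -> exists2 i, i \in V & (0 < m i)%N.
Proof.
have -> : variable_ideal V p <->
          monomial_ideal (fun m => exists2 i, i \in V & m = U_(i)%MM) p.
  split=> -[s [Gs ->]]; exists s; split=> // x /Gs.
    by case=> i V_i ->; exists U_(i)%MM => //; exists i.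
  by case=> _ [i V_i ->] ->; exists i.
rewrite monomial_idealP; split=> Vp m /Vp.
  by case=> _ [i V_i ->]; rewrite lep1mP -lt0n; exists i.
by case=> i V_i m_i; exists U_(i)%MM; [exists i | rewrite lep1mP -lt0n].
Qed.

Lemma msuppMX_shift p u m : (m + u)%MM \in msupp (p * 'X_[u]) = (m \in msupp p).
Proof.
by rewrite (perm_mem (msuppMX _ _)) addmC mem_map // => x y /addmI.
Qed.

Lemma colon_monomial_idealP A u p :
  colon_ideal (monomial_ideal A) (monomial_ideal (fun m => m = u)) p <->
  forall m, m \in msupp p -> exists2 a, A a & (a <= m + u)%MM.
Proof.
split=> [colon m p_m | Ap q /monomial_idealP u_q].
  have /colon/monomial_idealP : monomial_ideal (fun m => m = u) ('X_[u] : S).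
    by apply/monomial_idealX; exists u; rewrite ?lepm_refl.
  by apply; rewrite msuppMX_shift.
apply/monomial_idealP=> _ /msuppM_le/allpairsP[[a b] /= [p_a /u_q[_ -> le_ub] ->]].
have [c Ac le_c] := Ap a p_a; exists c => //; apply: lepm_trans le_c _.
by apply/mnm_lepP=> i; rewrite !mnmDE leq_add2l; apply: (mnm_lepP le_ub).
Qed.

Lemma linear_quotients_of_seq d hs :
  uniq hs -> equigenerated d hs -> linear_quotient_seq hs ->
  linear_quotients (monomial_ideal (K := K) (fun m => m \in hs)).
Proof.
move=> hs_uniq hs_d lq; exists hs; split.
  split=> // u hs_u /monomial_idealX[a]; rewrite mem_rem_uniq // !inE.
  move=> /andP[a'u hs_a].
  by move=> le_au; case/eqP: a'u; apply: lepm_mdeg_eq le_au _; rewrite !hs_d.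
move=> j /andP[_ lt_j]; set v := nth _ _ _.
have v'take : v \notin take j hs.
  apply/negP=> /(nthP 0%MM)[k]; rewrite size_take lt_j => lt_kj /eqP.
  by rewrite nth_take // nth_uniq ?(ltn_trans lt_kj) // ltn_eqF.
exists [set i | has (fun w => (w <= U_(i) + v)%MM) (take j hs)] => p.
rewrite colon_monomial_idealP variable_idealP; split=> Hp m /Hp.
  case=> w take_w /mnm_lepP le_w.
  have [i lt_i [w' take_w' le_w']] := lq j lt_j w take_w.
  exists i; first by rewrite inE; apply/hasP; exists w'.
  by move: (le_w i); rewrite mnmDE -/v in lt_i *; lia.
case=> i; rewrite inE => /hasP[w take_w le_w] m_i; exists w => //.
apply: lepm_trans le_w _; apply/mnm_lepP=> k; rewrite !mnmDE leq_add2r mnm1E.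
by case: eqP => [<-|].
Qed.

End MonomialIdealMembership.

(** * Shifts of the first syzygy module *)

Section FirstShifts.
Variables (K : fieldType) (n : nat) (F : free_complex K n).
Variables (d : nat) (us : seq 'X_{1..n}).
Hypothesis us_d : equigenerated d us.
Hypothesis resF : minimal_multigraded_resolution F (monomial_ideal (fun m => m \in us)).

Local Notation S := {mpoly K[n]}.
Local Notation aug := (aug F).
Local Notation diff := (diff F).
Local Notation shift i := (@shift K n F i).

Let multiF : multigraded F. Proof. by case: resF. Qed.
Let resolF : resolves F (monomial_ideal (fun m => m \in us)).
Proof. by case: resF. Qed.
Let minF : minimal F. Proof. by case: resF. Qed.

(** By multigrading, the entries of the augmentation are scalar multiples of the
    monomials given by the shifts ([augE]). *)
Definition aug_coef (j : 'I_(rank F 0)) : K := (aug j 0)@_(shift 0 j).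

Lemma augE j : aug j 0 = aug_coef j *: 'X_[shift 0 j].
Proof.
apply/mpolyP=> m; rewrite mcoeffZ mcoeffX; case: eqP => [<-|m'j].
  by rewrite mulr1.
rewrite mulr0; apply: memN_msupp_eq0; apply/negP=> /multiF.1 mE.
by rewrite mE in m'j.
Qed.

(** By minimality boundaries, and hence cycles, have no constant terms. *)
Lemma diff_no_const i (w : 'rV[S]_(rank F i.+1)) k : ((w *m diff i) 0 k)@_0%MM = 0.
Proof.
rewrite mxE raddf_sum /= big1 // => j _; apply: memN_msupp_eq0; apply/negP.
move=> /msupp_mulX[u /((variable_idealP _ _).1 (minF j k))[l _]] u_l /mnm_lepP/(_ l).
by rewrite mnm0E leqNgt u_l.
Qed.

Lemma cycle0_no_const (v : 'rV[S]_(rank F 0)) k : v *m aug = 0 -> (v 0 k)@_0%MM = 0.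
Proof. by have [_ ex0 _] := resolF; move/ex0=> [w ->]; apply: diff_no_const. Qed.

Lemma cycleS_no_const i (v : 'rV[S]_(rank F i.+1)) k :
  v *m diff i = 0 -> (v 0 k)@_0%MM = 0.
Proof. by have [_ _ exS] := resolF; move/exS=> [w ->]; apply: diff_no_const. Qed.

Lemma delta_aug j :
  (delta_mx 0 j : 'rV[S]__) *m aug = (aug_coef j *: 'X_[shift 0 j])%:M.
Proof. by rewrite -rowE; apply/matrixP=> a b; rewrite !ord1 !mxE augE eqxx mulr1n. Qed.

Lemma aug_coef_neq0 j : aug_coef j != 0.
Proof.
apply/eqP=> c0; have := @cycle0_no_const (delta_mx 0 j) j.
rewrite delta_aug c0 scale0r raddf0 mxE !eqxx mcoeff1 eqxx => /(_ erefl)/eqP.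
by rewrite oner_eq0.
Qed.

(** The shifts in degree 0 are pairwise incomparable for divisibility: otherwise
    [e_j - c x^(a_j - a_k) e_k] would be a cycle with a constant term. *)
Lemma shift0_inj_dvd j k : (shift 0 k <= shift 0 j)%MM -> k = j.
Proof.
move=> le_kj; apply/eqP; apply: contraT => k'j.
pose c := aug_coef j / aug_coef k.
pose v : 'rV[S]_(rank F 0) :=
  delta_mx 0 j - (c *: 'X_[(shift 0 j - shift 0 k)%MM]) *: delta_mx 0 k.
have := @cycle0_no_const v j; rewrite mulmxBl -scalemxAl !delta_aug.
rewrite scale_scalar_mx -scalerAr -scalerAl -mpolyXD submK // scalerA.
rewrite mulrC divfK ?aug_coef_neq0 // subrr => /(_ erefl).
rewrite !mxE !eqxx eq_sym (negbTE k'j) mulr0 subr0 mcoeff1 eqxx => /eqP.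
by rewrite oner_eq0.
Qed.

Lemma msupp_mulmx_dvd p q (v : 'M[S]_(1, p)) (A : 'M[S]_(p, q)) j m :
  m \in msupp ((v *m A) 0 j) -> exists i, exists2 u, u \in msupp (A i j) & (u <= m)%MM.
Proof.
rewrite mxE => /msupp_sum_le/flattenP[_ /mapP[i _ ->]] /msupp_mulX[u A_u le_u].
by exists i, u.
Qed.

Lemma shift0_in_aug j : shift 0 j \in msupp (aug j 0).
Proof. by rewrite mcoeff_msupp aug_coef_neq0. Qed.

Lemma dvd_shift0 j : exists2 u, u \in us & (u <= shift 0 j)%MM.
Proof.
have [memI _ _] := resolF.
have /monomial_idealP : monomial_ideal (fun m => m \in us) (aug j 0).
  by apply/memI; exists (delta_mx 0 j); rewrite -rowE mxE.
by apply; apply: shift0_in_aug.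
Qed.

Lemma gen_shift0 m : m \in us -> exists j, shift 0 j = m.
Proof.
move=> us_m; have [memI _ _] := resolF.
have /memI[v vE] : monomial_ideal (K := K) (fun m => m \in us) 'X_[m].
  by apply/monomial_idealX; exists m; rewrite ?lepm_refl.
have : m \in msupp ((v *m aug) 0 0) by rewrite -vE msuppX inE.
move=> /msupp_mulmx_dvd[j [w /multiF.1->] le_jm]; exists j.
have [u us_u le_uj] := dvd_shift0 j.
have uE : u = m.
  by apply: lepm_mdeg_eq; [apply: lepm_trans le_jm | rewrite !us_d].
apply: lepm_mdeg_eq => //; apply/eqP.
by rewrite eqn_leq lepm_mdeg //= -uE lepm_mdeg.
Qed.

Lemma shift0_gen j : shift 0 j \in us.
Proof.
have [u us_u le_uj] := dvd_shift0 j; have [k kE] := gen_shift0 us_u.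
by rewrite -(@shift0_inj_dvd j k) kE.
Qed.

Lemma shift1_of_linear_syzygy m :
  linear_syzygy d us m -> exists l, (shift 1 l <= m)%MM.
Proof.
move=> [_ [u [v [us_u us_v u'v le_u le_v]]]].
have [j jE] := gen_shift0 us_u; have [k kE] := gen_shift0 us_v.
rewrite -{}jE in u'v le_u *; rewrite -{}kE in u'v le_v.
pose w : 'rV[S]_(rank F 0) :=
  (aug_coef k *: 'X_[(m - shift 0 j)%MM]) *: delta_mx 0 j -
  (aug_coef j *: 'X_[(m - shift 0 k)%MM]) *: delta_mx 0 k.
have [_ ex0 _] := resolF.
have /ex0[w' wE] : w *m aug = 0.
  rewrite mulmxBl -!scalemxAl !delta_aug !scale_scalar_mx -!scalerAr -!scalerAl.
  by rewrite -!mpolyXD !submK // !scalerA mulrC subrr.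
have k'j : (j == k) = false by apply: contraNF u'v => /eqP->.
have : (m - shift 0 j)%MM \in msupp ((w' *m diff 0) 0 j).
  rewrite -wE mcoeff_msupp !mxE !eqxx k'j mulr0 subr0 mulr1 mcoeffZ mcoeffX eqxx mulr1.
  exact: aug_coef_neq0.
move=> /msupp_mulmx_dvd[l [b /multiF.2 bE le_b]]; exists l; rewrite -bE.
by rewrite -(submK le_u); apply/mnm_lepP=> i; rewrite !mnmDE leq_add2r (mnm_lepP le_b).
Qed.

(** The row of the first differential given by [k] is nonzero, since otherwise a
    basis vector would be a cycle; being a relation, it has two nonzero entries. *)
Lemma linear_syzygy_dvd_shift1 k :
  linearly_related d us ->
  exists2 m, linear_syzygy d us m & (m <= shift 1 k)%MM.
Proof.
move=> rel; pose r := delta_mx 0 k *m diff 0 : 'rV[S]_(rank F 0).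
have r_dvd j : r 0 j != 0 -> (shift 0 j <= shift 1 k)%MM.
  rewrite -msupp_eq0 /r -rowE mxE; case E : (msupp _) => [|m s] // _.
  by rewrite -(multiF.2 _ k j m) ?lem_addl // E mem_head.
have [_ ex0 _] := resolF.
have r_aug : r *m aug = 0 by apply/ex0; exists (delta_mx 0 k).
have [j rj] : exists j, r 0 j != 0.
  apply/existsP; apply: contraT => /existsPn r0.
  have : delta_mx 0 k *m diff 0 = 0 :> 'rV[S]__.
    by apply/rowP=> j; rewrite [RHS]mxE; apply/eqP; rewrite -[_ == _]negbK; apply: r0.
  move/cycleS_no_const=> /(_ k)/eqP; rewrite mxE !eqxx mcoeff1 eqxx.
  by rewrite oner_eq0.
have [j' j'j rj'] : exists2 j', j' != j & r 0 j' != 0.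
  apply/exists_inP; apply: contraT => /exists_inPn r0.
  have /matrixP/(_ 0 0) := r_aug; rewrite !mxE (bigD1 j) //= big1 ?addr0.
    move/eqP; rewrite mulf_eq0 (negbTE rj) /= => /eqP aug0.
    by have := shift0_in_aug j; rewrite aug0 msupp0.
  by move=> i /r0; rewrite negbK => /eqP->; rewrite mul0r.
have ne : shift 0 j' != shift 0 j.
  apply: contraNneq j'j => eq_s.
  by rewrite (shift0_inj_dvd (j := j) (k := j')) // eq_s lepm_refl.
have [m [syz_m _ le_m]] :=
  linear_syzygy_step us_d rel (shift0_gen j) (shift0_gen j') ne
    (r_dvd _ rj) (r_dvd _ rj').
by exists m.
Qed.

Lemma homological_shift1P (p : S) :
  linearly_related d us ->
  homological_shift_ideal 1 F p <-> monomial_ideal (linear_syzygy d us) p.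
Proof.
move=> rel; split; apply: monomial_ideal_sub => m.
  by case=> k ->; apply: linear_syzygy_dvd_shift1.
by move=> /shift1_of_linear_syzygy[l le_l]; exists (shift 1 l) => //; exists l.
Qed.

End FirstShifts.

Lemma monomial_ideal_ext (K : fieldType) (n : nat) (A B : 'X_{1..n} -> Prop)
    (p : {mpoly K[n]}) :
  (forall m, A m <-> B m) -> monomial_ideal A p <-> monomial_ideal B p.
Proof.
move=> AB; split; apply: monomial_ideal_sub => m /AB Bm;
  by exists m; rewrite ?lepm_refl.
Qed.

Lemma linear_quotients_ext (K : fieldType) (n : nat) (I J : {mpoly K[n]} -> Prop) :
  (forall p, I p <-> J p) -> linear_quotients I -> linear_quotients J.
Proof.
move=> IJ [hs [[hs_uniq hsP hs_min] lq]]; exists hs; split=> //; split=> // p.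
by rewrite -IJ.
Qed.

Lemma minimal_multigraded_resolution_ext (K : fieldType) (n : nat)
    (F : free_complex K n) (I J : {mpoly K[n]} -> Prop) :
  (forall p, I p <-> J p) ->
  minimal_multigraded_resolution F I -> minimal_multigraded_resolution F J.
Proof.
by move=> IJ [mF [resI ex0 exS] minF]; split=> //; split=> // p; rewrite -IJ.
Qed.

(** HS_1 of a monomial ideal generated in one degree inherits linear quotients. *)
Theorem homological_shift1_linear_quotients (K : fieldType) (n d : nat)
    (us : seq 'X_{1..n}) (F : free_complex K n) :
  uniq us -> equigenerated d us -> linear_quotient_seq us ->
  minimal_multigraded_resolution F (monomial_ideal (fun m => m \in us)) ->
  linear_quotients (homological_shift_ideal 1 F).
Proof.
move=> us_uniq us_d lq resF.
have [hs [hs_uniq lq_hs hsP]] := linear_quotient_seq_syzygy us_uniq us_d lq.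
apply: linear_quotients_ext (linear_quotients_of_seq K (d := d.+1) hs_uniq _ lq_hs).
  move=> p; rewrite (homological_shift1P us_d resF).
    exact: monomial_ideal_ext.
  exact: linear_quotient_seq_related.
by move=> m /hsP[].
Qed.

Theorem theorem5p2 (K : fieldType) (n d t : nat)
    (n_gt0 : (0 < n)%N) (d_gt0 : (0 < d)%N) (t_gt0 : (0 < t)%N)
    (le_dn : (d <= n)%N) (le_tn : (t <= n)%N) (F : free_complex K n)
    (resF : minimal_multigraded_resolution F (t_spread_veronese K n d t)) :
  linear_quotients (homological_shift_ideal 1 F).
Proof.
have [us [us_uniq lq usP]] := t_spread_linear_quotient_seq n d t_gt0.
apply: (@homological_shift1_linear_quotients K n d us) => //.
  by move=> m /usP/(t_spreadP _ _ t_gt0)[].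
apply: minimal_multigraded_resolution_ext resF => p.
by apply: monomial_ideal_ext => m; split=> /usP.
Qed.
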